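(* Let $p$ be a positive integer, let $\boldsymbol{\beta}=(\beta_0,\ldots,\beta_{p-1})$ be an alternate base of length $p$, let $\delta=\prod_{i=0}^{p-1}\beta_i$, and let $\boldsymbol{D}=(D_0,\ldots,D_{p-1})$ be a $p$-tuple of alphabets of integers containing $0$. If $\delta$ is a Pisot number and $\beta_i\in\mathbb{Q}(\delta)$ for all $i\in\{0,\ldots,p-1\}$, then the normalization function $\nu_{\boldsymbol{\beta},\boldsymbol{D}}$ is computable by a finite Büchi automaton.
   Context: $\mathbb N=\{0,1,2,\dots\}$; alphabets are finite sets. An alternate base of length $p$ is a $p$-tuple $\boldsymbol\beta=(\beta_0,\ldots,\beta_{p-1})$ of real numbers greater than $1$. Each $D_i$ is a finite set of integers with $0\in D_i$. For all $n\in\mathbb Z$, $\beta_n=\beta_{n\bmod p}$ and $D_n=D_{n\bmod p}$. For an infinite sequence of integers $a=a_0a_1a_2\cdots$, $\mathrm{val}_{\boldsymbol\beta}(a)=\sum_{n=0}^{+\infty}\frac{a_n}{\prod_{k=0}^n\beta_k}$ (when convergent); $a$ is a $\boldsymbol\beta$-representation of $x$ if $\mathrm{val}_{\boldsymbol\beta}(a)=x$. For $x\in[0,1]$, the $\boldsymbol\beta$-expansion $d_{\boldsymbol\beta}(x)=\varepsilon_0(x)\varepsilon_1(x)\cdots$ is given by the greedy algorithm: $\varepsilon_0(x)=\lfloor\beta_0x\rfloor$, $r_0(x)=\beta_0x-\varepsilon_0(x)$, and for $n\ge1$, $\varepsilon_n(x)=\lfloor\beta_nr_{n-1}(x)\rfloor$,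 $r_n(x)=\beta_nr_{n-1}(x)-\varepsilon_n(x)$. The normalization function $\nu_{\boldsymbol\beta,\boldsymbol D}:(\bigcup_{i=0}^{p-1}D_i)^{\mathbb N}\to(\bigcup_{i=0}^{p-1}\{0,\ldots,\lceil\beta_i\rceil-1\})^{\mathbb N}$ is the partial function mapping any $\boldsymbol\beta$-representation $a$ with $a_n\in D_n$ for all $n\in\mathbb N$ of a real number $x\in[0,1)$ to $d_{\boldsymbol\beta}(x)$. It is said to be computable by a finite Büchi automaton if there exists a finite Büchi automaton accepting the set of all pairs $(u,v)$ of infinite words (seen as infinite words over the alphabet of pairs $\bigcup_{i=0}^{p-1}(D_i\times\{0,\ldots,\lceil\beta_i\rceil-1\})$) such that $u_n\in D_n$ and $v_n\in\{0,\ldots,\lceil\beta_n\rceil-1\}$ for all $n\in\mathbb N$, $\mathrm{val}_{\boldsymbol\beta}(u)=\mathrm{val}_{\boldsymbol\beta}(v)$, and $v=d_{\boldsymbol\beta}(x)$ for some $x\in[0,1)$. A Büchi automaton is a quintuple $(Q,I,F,B,E)$ with states $Q$, initial states $I\subseteq Q$, final states $F\subseteq Q$, finite alphabet $B$ and transitions $E\subseteq Q\times B\times Q$ (not necessarily deterministic). It is finite if $Q$ is finite. An infinite word is accepted if it labels an infinite path starting in an initial state and visiting final states infinitely many times. The set accepted is the set of all accepted infinite words. A Pisot number is an algebraic integer $\beta>1$ whose Galois conjugates (other than $\beta$ itself) all have modulus less than $1$. *)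

(* Defs.v *)
From HB Require Import structures.
From mathcomp Require Import all_boot all_order all_algebra finmap.
From mathcomp Require Import mathcomp_extra boolp classical_sets reals topology.
From mathcomp Require Import normedtype sequences.
From mathcomp Require Import complex.

Set Implicit Arguments.
Unset Strict Implicit.
Unset Printing Implicit Defensive.

Import Order.TTheory GRing.Theory Num.Theory.
Import numFieldNormedType.Exports.

Local Open Scope fset_scope.
Local Open Scope classical_set_scope.
Local Open Scope ring_scope.

Record finite_buchi (B : finType) := FiniteBuchi {
  buchi_state : finType;
  buchi_init : {set buchi_state};
  buchi_final : {set buchi_state};
  buchi_trans : {set buchi_state * B * buchi_state}
}.

Definition buchi_accepts (B : finType) (A : finite_buchi B) (w : nat -> B) :
    Prop :=
  exists q : nat -> buchi_state A,
    [/\ q 0%N \in buchi_init A,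
        forall n, (q n, w n, q n.+1) \in buchi_trans A
      & forall N : nat, exists2 n, (N <= n)%N & q n \in buchi_final A].

Definition buchi_language (B : finType) (A : finite_buchi B) :
    set (nat -> B) :=
  [set w | buchi_accepts A w].

(** The minimal polynomial of [x] over the rationals is the only monic
    irreducible rational polynomial vanishing at [x]. *)
Definition galois_conjugate (R : realType) (x : R) (z : R[i]) : Prop :=
  exists m : {poly rat},
    [/\ m \is monic, irreducible_poly m,
        root (map_poly ratr m) x & root (map_poly ratr m) z].

Definition pisot (R : realType) (x : R) : Prop :=
  [/\ integralOver (intr : int -> R) x, 1 < x
    & forall z : R[i], galois_conjugate x z -> z != x%:C%C -> `|z| < 1].

(** The smallest subfield of [R] containing [x]; [divring_closed] is closure
    under [1], subtraction and division, so every such [S] contains the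
    rationals. *)
Definition adjoinQ (R : realType) (x : R) : set R :=
  [set y | forall S : {pred R},
             GRing.divring_closed S -> x \in S -> y \in S].

(** In the definitions below a base and a tuple of alphabets are indexed by all
    natural numbers through reduction modulo [p]; the default values of [nth]
    are never reached when [p] is positive. *)
Section AlternateBase.
Variables (R : realType) (p : nat).
Implicit Types (beta : p.-tuple R) (D : p.-tuple {fset int}).

Definition base beta (n : nat) : R := nth 1 beta (n %% p).

Definition alphabet D (n : nat) : {fset int} := nth fset0 D (n %% p).

(** The series converges whenever the digits of [a] are bounded and the
    elements of [beta] are greater than [1], in particular for sequences over
    finite alphabets. *)
Definition beta_val beta (a : nat -> int) : R :=
  limn (series (fun n => (a n)%:~R / \prod_(k < n.+1) base beta k)).

Fixpoint remainder beta (x : R) (n : nat) : R :=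
  let y := base beta n * (if n is m.+1 then remainder beta x m else x) in
  y - (Num.floor y)%:~R.

Definition expansion beta (x : R) (n : nat) : int :=
  Num.floor (base beta n * (if n is m.+1 then remainder beta x m else x)).

(** [{0, ..., ceil b - 1}], for [b] nonnegative. *)
Definition digits (b : R) : {fset int} :=
  [fset (k%:Z) | k in iota 0 `|Num.ceil b|%N].

Definition pair_alphabet beta D : {fset int * int} :=
  \bigcup_(i <- enum 'I_p) (tnth D i `*` digits (tnth beta i)).

(** The graph of the normalization function, as a set of infinite words over
    the alphabet of pairs: [w] encodes the pair of words [(u, v)]. *)
Definition normalization_graph beta D : set (nat -> pair_alphabet beta D) :=
  [set w |
    let u n := (fsval (w n)).1 in
    let v n := (fsval (w n)).2 in
    [/\ forall n, u n \in alphabet D n,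
        forall n, v n \in digits (base beta n),
        beta_val beta u = beta_val beta v
      & exists2 x : R, 0 <= x < 1 & forall n, v n = expansion beta x n]].

Definition normalization_buchi_computable beta D : Prop :=
  exists A : finite_buchi (pair_alphabet beta D),
    buchi_language A = @normalization_graph beta D.

End AlternateBase.

(* Main.v *)
Require Import Defs.
From mathcomp Require Import all_boot all_order all_algebra finmap.
From mathcomp Require Import mathcomp_extra boolp classical_sets reals.
From mathcomp Require Import topology normedtype sequences.
From mathcomp Require Import complex separable polyorder.
From mathcomp Require Import zify lra ring.

Set Implicit Arguments.
Unset Strict Implicit.
Unset Printing Implicit Defensive.

Import Order.TTheory GRing.Theory Num.Theory.
Import numFieldNormedType.Exports.
Local Open Scope ring_scope.

(** Reading a pair of words (u, v) letter by letter, a finite automaton has to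
    check two things: that u and v have the same value, and that v is greedy.
    Both are read off orbits of the expanding recurrence
    y_(n+1) = beta_n y_n + a_n with bounded integers a_n.

    For the values, let s_0 = 0 and s_(n+1) = beta_n s_n + (u_n - v_n).  Since
    the recurrence is expanding, its only bounded solution is the one starting
    from the value of the digits - a_n ([bounded_orbit_series_cvg]), and this
    solution exists ([bounded_orbit_exists]).  So u and v have the same value
    exactly when s is bounded.

    For greediness, let x_n be the value of the tail of v from position n, in
    the base shifted by n.  Nonnegative digits v are the expansion of some x in
    [0, 1) exactly when x_n < 1 for all n.  To check all these inequalities at
    once, without Parry's lexicographic criterion, keep the strongest pending
    one in the form x_n < t_n: start from t_0 = 1; as
    x_(n+1) = beta_n x_n - v_n, the inequality x_n < t_n becomes
    x_(n+1) < beta_n t_n - v_n, and with x_(n+1) < 1 this gives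
    t_(n+1) = min (1, beta_n t_n - v_n).  If all t_n are positive, the same
    expansion argument gives x_n <= t_n; the inequality is strict for all n
    exactly when the minimum is infinitely often strictly below
    beta_n t_n - v_n (call this a reset of t to 1), because otherwise t is
    eventually a bounded orbit for v and coincides with the tails
    ([lt_threshold], [threshold_reset]).  This is a Buchi condition.

    It remains to see that, over all pairs of words to be accepted, s and t take
    finitely many values: this is where the Pisot hypothesis enters
    ([pisot_orbit_finite]).  The position n mod p, the values s_n and t_n and
    one bit recording a reset then form the state of the automaton.  Multiplying
    the n-th term of an orbit by the remaining bases of its period, and by a
    common denominator N, turns it into f(delta) with f an integer polynomial.
    The real number f(delta) stays bounded since the orbit does.  At every other
    conjugate z of delta, f(z) changes by bounded amounts inside a period and is
    multiplied by z, of modulus less than 1, at the end of the period, so it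
    stays bounded as well; a reset of t restarts f from one of finitely many
    polynomials.  Integer polynomials modulo the minimal polynomial of
    delta are determined by their values at the conjugates through an invertible
    Vandermonde matrix, so bounded values leave finitely many of them
    ([bounded_conjugates_finite]). *)

(** * Bounded orbits of an expanding recurrence *)

(** A positive term would force at least linear growth: from then on g is
    nondecreasing and gains at least (c - 1) g_N at each step. *)
Lemma bounded_expanding_le0 (R : realType) (b : nat -> R) (c C : R)
    (g : nat -> R) (N : nat) :
  1 < c -> (forall n, c <= b n) -> (forall n, g n <= C) ->
  (forall n, (N <= n)%N -> b n * g n <= g n.+1) -> g N <= 0.
Proof.
move=> c1 cb gC gS; rewrite leNgt; apply/negP => gN.
have cg : 0 < (c - 1) * g N by rewrite mulr_gt0//; lra.
have grow k : g N + k%:R * ((c - 1) * g N) <= g (N + k)%N.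
  elim: k => [|k IHk]; first by rewrite addn0; lra.
  have gNk : g N <= g (N + k)%N.
    by apply: le_trans IHk; rewrite lerDl mulr_ge0// ltW.
  have := gS (N + k)%N (leq_addr _ _); rewrite addnS; apply: le_trans.
  apply: (@le_trans _ _ (c * g (N + k)%N)); last first.
    by rewrite ler_wpM2r// (le_trans (ltW gN)).
  have : (c - 1) * g N <= (c - 1) * g (N + k)%N by rewrite ler_wpM2l//; lra.
  rewrite -natr1; lra.
have C0 : 0 <= C by apply: le_trans (gC N); exact: ltW.
set k := Num.bound (C / ((c - 1) * g N)).
have /archi_boundP : 0 <= C / ((c - 1) * g N) by rewrite divr_ge0// ltW.
rewrite -/k ltr_pdivrMr// => Ck.
by have := le_trans (grow k) (gC _); lra.
Qed.

(** Unrolling the recurrence, y_0 = (partial sum) + y_n / (b_0 ... b_(n-1)), and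
    the last term tends to 0 when y is bounded. *)
Lemma bounded_orbit_series_cvg (R : realType) (b : nat -> R) (c C : R)
    (e y : nat -> R) :
  1 < c -> (forall n, c <= b n) -> (forall n, `|y n| <= C) ->
  (forall n, y n.+1 = b n * y n - e n) ->
  (series (fun n => e n / \prod_(k < n.+1) b k) @ \oo --> y 0%N)%classic.
Proof.
move=> c1 cb yC yS.
have c0 : 0 < c by rewrite (lt_trans _ c1).
have b0 n : 0 < b n by rewrite (lt_le_trans c0).
have P0 n : 0 < \prod_(k < n) b k by rewrite prodr_gt0.
have sE n : series (fun n => e n / \prod_(k < n.+1) b k) n
    = y 0%N - y n / \prod_(k < n) b k.
  elim: n => [|n IHn].
    by rewrite /series/= big_nat big_pred0_eq// big_ord0 divr1 subrr.
  rewrite seriesSr IHn big_ord_recr/= yS.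
  have := P0 n; have := b0 n; move: (\prod_(k < n) _) (b n) => P B B0 PP.
  by field; rewrite !gt_eqF.
have Pc n : c ^+ n <= \prod_(k < n) b k.
  rewrite -[n in c ^+ n]card_ord -prodr_const.
  by apply: ler_prod => i _; rewrite ltW//=.
rewrite (_ : series _ = fun n => y 0%N - y n / \prod_(k < n) b k); last first.
  exact/funext.
suff y0 : (y n / (\prod_(k < n) b k) @[n --> \oo] --> (0 : R))%classic.
  have -> : nbhs (y 0%N) = nbhs (y 0%N - 0) by rewrite subr0.
  by apply: cvgB y0; exact: cvg_cst.
have cV : `|c^-1| < 1 by rewrite ger0_norm ?invr_ge0 ?(ltW c0)// invf_lt1.
apply/norm_cvg0P; apply: (@squeeze_cvgr _ _ _ _ (fun=> 0) (geometric C c^-1)).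
- near=> n; rewrite normr_ge0/= normrM.
  rewrite normfV (ger0_norm (ltW (P0 _))) ler_pM ?invr_ge0 ?(ltW (P0 _))//.
  by rewrite exprVn lef_pV2 ?posrE ?exprn_gt0.
- exact: cvg_cst.
- exact: cvg_geometric.
Unshelve. all: by end_near. Qed.

(** The orbit consists of the tails of the series, rescaled.  Convergence and
    the bound come together from the nested intervals of center the partial sums
    and of radius K / (b_0 ... b_(n-1)): the choice K = M / (c - 1) makes each
    one contain the next. *)
Lemma bounded_orbit_exists (R : realType) (b : nat -> R) (c M : R)
    (e : nat -> R) :
  1 < c -> (forall n, c <= b n) -> (forall n, `|e n| <= M) ->
  exists y : nat -> R,
    (forall n, `|y n| <= M / (c - 1)) /\ (forall n, y n.+1 = b n * y n - e n).
Proof.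
move=> c1 cb eM; set K := M / (c - 1).
have c0 : 0 < c by rewrite (lt_trans _ c1).
have b0 n : 0 < b n by rewrite (lt_le_trans c0).
pose P n := \prod_(k < n) b k.
have P0 n : 0 < P n by rewrite prodr_gt0.
have KE : K * (c - 1) = M by rewrite divfK// gt_eqF// subr_gt0.
have K0 : 0 <= K by rewrite divr_ge0 ?(le_trans _ (eM 0%N))// subr_ge0 ltW.
pose S n := \sum_(i < n) e i / P i.+1.
have PS n : P n.+1 = P n * b n by rewrite /P big_ord_recr.
have SS n : S n.+1 = S n + e n / P n.+1 by rewrite /S big_ord_recr.
have eK n : `|e n| <= (b n - 1) * K.
  rewrite (le_trans (eM n))// -KE mulrC ler_wpM2r// lerB//.
have PV n : (P n)^-1 = b n / P n.+1.
  by rewrite PS invfM mulrCA mulfV ?mulr1// gt_eqF.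
pose U n := S n + K / P n; pose L n := S n - K / P n.
have UP n : U n.+1 <= U n.
  rewrite /U SS (PV n) -addrA lerD2l mulrA -mulrDl ler_pM2r ?invr_gt0 //.
  by have := eK n; rewrite ler_norml => /andP[]; lra.
have LP n : L n <= L n.+1.
  rewrite /L SS (PV n) -addrA lerD2l mulrA -mulrBl -mulNr ler_pM2r ?invr_gt0 //.
  by have := eK n; rewrite ler_norml => /andP[]; lra.
have LU n : L n <= U n.
  have : 0 <= K / P n by rewrite divr_ge0// ltW.
  by rewrite /L /U; lra.
have Udec : nonincreasing_seq U by apply/nonincreasing_seqP.
have Linc : nondecreasing_seq L by apply/nondecreasing_seqP.
have LUn m n : L m <= U n.
  rewrite (@le_trans _ _ (L (maxn m n)))//; first exact/Linc/leq_maxl.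
  by rewrite (le_trans (LU _))//; exact/Udec/leq_maxr.
have Ucvg : cvgn U.
  apply: nonincreasing_is_cvgn => //; exists (L 0%N) => _ [n _ <-].
  exact: LUn.
pose l := limn U.
have lU n : l <= U n by exact: nonincreasing_cvgn_ge.
have Ll n : L n <= l by apply: limr_ge => //; near=> k; exact: LUn.
exists (fun n => P n * (l - S n)); split => n.
  rewrite normrM ger0_norm ?(ltW (P0 n))// mulrC -ler_pdivlMr //.
  rewrite ler_norml; have := lU n; have := Ll n; rewrite /L /U; lra.
rewrite SS PS; have := P0 n; have := b0 n => ? ?.
by field; rewrite !gt_eqF.
Unshelve. all: by end_near. Qed.

(** * Greedy expansions through thresholds *)

(** Here r stands for the tails of v.  Both 0 <= r and r <= t follow from
    [bounded_expanding_le0], applied to - r and to r - t.  If r_n = t_n, then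
    r and t follow the same recurrence from n on and no reset occurs after n. *)
Lemma lt_threshold (R : realType) (b : nat -> R) (c C : R) (v : nat -> int)
    (r t : nat -> R) :
  1 < c -> (forall n, c <= b n) -> (forall n, 0 <= v n) ->
  (forall n, `|r n| <= C) -> (forall n, r n.+1 = b n * r n - (v n)%:~R) ->
  (forall n, 0 < t n) ->
  (forall n, t n.+1 = Num.min 1 (b n * t n - (v n)%:~R)) ->
  (forall N : nat, exists2 n, (N <= n)%N & 1 < b n * t n - (v n)%:~R) ->
  forall n, 0 <= r n < t n.
Proof.
move=> c1 cb v0 rC rS t0 tS tI n.
have vR k : (0 : R) <= (v k)%:~R by rewrite ler0z.
have rN k : - r k <= C by apply: le_trans (rC k); rewrite -normrN ler_norm.
have rP k : r k <= C by apply: le_trans (rC k); rewrite ler_norm.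
have r0 : 0 <= r n.
  rewrite -oppr_le0.
  apply: (@bounded_expanding_le0 _ b c C (fun k => - r k)) => // k _.
  by rewrite rS; have := vR k; lra.
have tle k : t k.+1 <= b k * t k - (v k)%:~R by rewrite tS ge_min lexx orbT.
have rt k : r k <= t k.
  rewrite -subr_le0.
  apply: (@bounded_expanding_le0 _ b c C (fun k => r k - t k)) => // j.
    by have := rP j; have := t0 j; lra.
  by move=> _; rewrite rS; have := tle j; lra.
rewrite r0 lt_neqAle rt andbT; apply/eqP => rtE.
have rtk k : r (n + k)%N = t (n + k)%N.
  elim: k => [|k IHk]; first by rewrite addn0.
  apply: le_anti; rewrite rt/= addnS (le_trans (tle _))// rS IHk//.
(* The reset at k >= n contradicts r <= t, since r and t agree from n on. *)
have [k nk] := tI n; rewrite -(subnKC nk) -rtk -rS -addnS => rk.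
have := rt (n + (k - n).+1)%N.
rewrite addnS tS le_min -addnS leNgt rk/=//.
Qed.

(** The converse of [lt_threshold].  Without a reset after N, the positive
    difference t - r would be multiplied by b_n at each later step, although it
    is bounded by 1. *)
Lemma threshold_reset (R : realType) (b : nat -> R) (c : R) (v : nat -> int)
    (r t : nat -> R) :
  1 < c -> (forall n, c <= b n) ->
  (forall n, 0 <= r n < 1) -> (forall n, r n.+1 = b n * r n - (v n)%:~R) ->
  t 0%N = 1 ->
  (forall n, t n.+1 = Num.min 1 (b n * t n - (v n)%:~R)) ->
  (forall n, r n < t n) /\
  (forall N : nat, exists2 n, (N <= n)%N & 1 < b n * t n - (v n)%:~R).
Proof.
move=> c1 cb r01 rS t0 tS.
have b0 n : 0 < b n by rewrite (lt_le_trans _ (cb n))// (lt_trans _ c1).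
have rt n : r n < t n.
  elim: n => [|n IHn]; first by rewrite t0; case/andP: (r01 0%N).
  rewrite tS lt_min; case/andP: (r01 n.+1) => _ -> /=.
  by rewrite rS ltrD2r ltr_pM2l.
split=> // N; apply: contrapT => noreset.
have t1 n : t n <= 1 by case: n => [|n]; rewrite ?t0// tS ge_min lexx.
have : t N - r N <= 0.
  apply: (@bounded_expanding_le0 _ b c 1 (fun k => t k - r k)) => // n.
    by have := t1 n; have /andP[] := r01 n; lra.
  move=> Nn; rewrite tS rS min_r; first by lra.
  by rewrite leNgt; apply/negP => tn; apply: noreset; exists n.
by have := rt N; lra.
Qed.

Definition greedy_tail (R : realType) (p : nat) (beta : p.-tuple R) (x : R)
    (n : nat) : R :=
  if n is m.+1 then remainder beta x m else x.

Lemma greedy_tailS (R : realType) (p : nat) (beta : p.-tuple R) (x : R) n :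
  greedy_tail beta x n.+1 =
    base beta n * greedy_tail beta x n - (expansion beta x n)%:~R.
Proof. by case: n. Qed.

Lemma greedy_tail_itv (R : realType) (p : nat) (beta : p.-tuple R) (x : R) n :
  0 <= x < 1 -> 0 <= greedy_tail beta x n < 1.
Proof.
case: n => // n _; rewrite greedy_tailS /expansion -/(greedy_tail beta x n).
have /andP[] := floor_itv (base beta n * greedy_tail beta x n).
by rewrite intrD; lra.
Qed.

(** A tail in [0, 1) forces its digit to be a floor, which is the greedy
    choice. *)
Lemma orbit_expansion (R : realType) (p : nat) (beta : p.-tuple R)
    (v : nat -> int) (r : nat -> R) :
  (forall n, 0 <= r n < 1) ->
  (forall n, r n.+1 = base beta n * r n - (v n)%:~R) ->
  forall n, v n = expansion beta (r 0%N) n.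
Proof.
move=> r01 rS n.
have vE k : v k = Num.floor (base beta k * r k).
  apply/esym/eqP; rewrite floor_eq intrD.
  by have := r01 k.+1; rewrite rS => /andP[]; lra.
suff rE : r n = greedy_tail beta (r 0%N) n by rewrite vE rE.
elim: n => // n IHn; rewrite greedy_tailS rS vE {1}IHn; congr (_ - _%:~R).
by rewrite IHn.
Qed.

(** * Rational polynomials at an algebraic integer *)

Lemma map_ratr_intr (K : numFieldType) (f : {poly int}) :
  map_poly ratr (map_poly intr f : {poly rat}) = map_poly intr f :> {poly K}.
Proof.
by rewrite -map_poly_comp; apply: eq_map_poly => a /=; rewrite ratr_int.
Qed.

(** A nonzero rational polynomial of least degree vanishing at x is irreducible
    and divides a monic integer polynomial; by Gauss's lemma, a scalar multiple
    of it is monic with integer coefficients. *)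
Lemma integral_irreducible_root (K : numFieldType) (x : K) :
  integralOver (intr : int -> K) x ->
  exists m : {poly int},
    [/\ m \is monic, irreducible_poly (map_poly intr m : {poly rat})
      & root (map_poly intr m) x].
Proof.
move=> [f f_monic fx].
pose P n := `[< exists q : {poly rat},
  [/\ size q = n, q != 0 & root (map_poly ratr q : {poly K}) x] >].
have exP : exists n, P n.
  exists (size (map_poly intr f : {poly rat})); apply/asboolP.
  exists (map_poly intr f); split=> //; last by rewrite map_ratr_intr.
  by rewrite monic_neq0// monic_map.
case: (ex_minnP exP) => n /asboolP[q [qn q0 qx]] qmin.
have min_dvd g : root (map_poly ratr g : {poly K}) x -> q %| g.
  move=> gx; rewrite /dvdp; apply/negP => /negP r0.
  have := qmin (size (g %% q)); rewrite leqNgt -qn ltn_modp q0 => /(_ _)/negP.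
  move=> h; apply: h => //; apply/asboolP; exists (g %% q); split => //.
  move: gx; rewrite {1}(divp_eq g q) rmorphD rmorphM/= /root hornerD hornerM.
  by rewrite (eqP qx) mulr0 add0r.
have q_irr : irreducible_poly q.
  split.
    rewrite ltnNge; apply/negP => /size1_polyC qE; move: qx q0.
    rewrite qE map_polyC rootC/= fmorph_eq0 polyC_eq0 => /eqP->.
    by rewrite eqxx.
  move=> g g1 gq; have /dvdpP[h qE] := gq.
  have : root (map_poly ratr h : {poly K}) x
      || root (map_poly ratr g : {poly K}) x.
    by rewrite -rootM -rmorphM -qE.
  have [h0 g0] : h != 0 /\ g != 0.
    by apply/andP; rewrite -negb_or -mulf_eq0 -qE.
  case/orP => /min_dvd; last by move=> qg; rewrite /eqp gq.
  move=> qh; have := dvdp_leq h0 qh; rewrite qE size_mul//.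
  have : (0 < size g)%N by rewrite size_poly_gt0.
  move: g1; case: (size g) => [|[|k]]// _ _; rewrite !addnS/= ltnNge leq_addr//.
have qf : q %| map_poly intr f by apply: min_dvd; rewrite map_ratr_intr.
have [g [a a0 qE] [h fE]] := dvdpP_rat_int qf.
have lgh : lead_coef g * lead_coef h = 1.
  by rewrite -lead_coefM -fE; exact/monicP.
pose e := lead_coef h.
have m_monic : e *: g \is monic.
  by rewrite monicE lead_coefZ mulrC lgh.
have e0 : e%:~R != 0 :> rat.
  rewrite intr_eq0; apply/eqP => he; move: lgh; rewrite -/e he mulr0.
  by move/eqP; rewrite eq_sym oner_eq0.
have mq : map_poly intr (e *: g) = (e%:~R / a) *: q :> {poly rat}.
  by rewrite map_polyZ/= qE scalerA divfK.
have ea0 : e%:~R / a != 0 by rewrite mulf_neq0// invr_eq0.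
exists (e *: g); split=> //.
  have qm : map_poly intr (e *: g) %= q by rewrite mq eqp_scale.
  split; first by rewrite (eqp_size qm) q_irr.
  move=> u u1; rewrite (eqp_dvdr _ qm) => uq.
  by rewrite (eqp_trans (q_irr.2 _ u1 uq))// eqp_sym.
by rewrite -map_ratr_intr mq map_polyZ rootZ// fmorph_eq0.
Qed.

(** The values at x of rational polynomials are already closed under division:
    a Bezout relation between m and g inverts a nonzero g(x). *)
Lemma adjoinQ_horner (R : realType) (x y : R) (m : {poly rat}) :
  irreducible_poly m -> root (map_poly ratr m) x -> adjoinQ x y ->
  exists f : {poly rat}, y = (map_poly ratr f).[x].
Proof.
move=> m_irr mx Qy.
pose S : {pred R} :=
  fun z => `[< exists f : {poly rat}, z = (map_poly ratr f).[x] >].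
have SP z :
    reflect (exists f : {poly rat}, z = (map_poly ratr f).[x]) (z \in S).
  exact: asboolP.
apply/SP; apply: (Qy S); last first.
  by apply/SP; exists 'X; rewrite map_polyX hornerX.
split.
- by apply/SP; exists 1; rewrite rmorph1 hornerC.
- move=> _ _ /SP[f ->] /SP[g ->]; apply/SP; exists (f - g).
  by rewrite rmorphB hornerD hornerN.
move=> _ _ /SP[f ->] /SP[g ->]; apply/SP.
have [gx0|gx0] := eqVneq (map_poly ratr g).[x] 0.
  by exists 0; rewrite gx0 invr0 mulr0 rmorph0 horner0.
have : coprimep m g.
  rewrite irreducible_poly_coprime//; apply: contra gx0 => /dvdpP[h ->].
  by rewrite rmorphM hornerM (eqP mx) mulr0.
move=> /Bezout_eq1_coprimepP[[h k] /= hk].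
exists (f * k); rewrite rmorphM hornerM; congr (_ * _).
apply: (mulIf gx0); rewrite mulVf//.
have := congr1 (fun q : {poly rat} => (map_poly (ratr : rat -> R) q).[x]) hk.
rewrite rmorphD !rmorphM/= hornerD !hornerM (eqP mx) mulr0 add0r => ->.
by rewrite rmorph1 hornerC.
Qed.

(** * Finiteness from bounded conjugates *)

(** In characteristic 0 the derivative is nonzero of smaller degree, hence
    coprime to an irreducible polynomial. *)
Lemma irreducible_rat_separable (m : {poly rat}) :
  irreducible_poly m -> separable_poly m.
Proof.
move=> m_irr; rewrite unlock irreducible_poly_coprime//.
have m1 : (1 < size m)%N by case: m_irr.
have sm' : size m^`() = (size m).-1 by rewrite size_deriv.
have m'0 : m^`() != 0 by rewrite -size_poly_gt0 sm' -ltnS prednK// ltnW.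
by apply/negP => /(dvdp_leq m'0); rewrite sm' -ltnS prednK ?ltnn// ltnW.
Qed.

Lemma bounded_int_poly_finite (d B : nat) :
  exists F : seq {poly int}, forall g : {poly int},
    (size g <= d)%N -> (forall i, (i < d)%N -> (absz (g`_i)%R <= B)%N) ->
    g \in F.
Proof.
(* Coefficients in [-B, B] are encoded by the shifts of [0, 2B] by B. *)
pose G (h : {ffun 'I_d -> 'I_(B + B).+1}) : {poly int} :=
  \sum_(i < d) ((h i : nat)%:Z - B%:Z) *: 'X^i.
exists (codom G) => g gd gB; apply/codomP.
exists [ffun i : 'I_d => inord (absz (g`_i + B%:Z))].
have gE : g = \poly_(i < d) g`_i.
  apply/polyP => i; rewrite coef_poly; case: ltnP => // di.
  by rewrite nth_default// (leq_trans gd).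
rewrite [LHS]gE poly_def; apply: eq_bigr => i _; rewrite ffunE; congr (_ *: _).
have := gB i (ltn_ord i) => giB.
by rewrite inordK; lia.
Qed.

Lemma complex_norm_bound (R : realType) (z : R[i]) :
  exists n : nat, `|z| <= n%:R.
Proof.
rewrite normc_def; set x := Num.sqrt _.
exists (Num.bound x); rewrite -(rmorph_nat (real_complex R)) lecR ltW//.
by rewrite archi_boundP// sqrtr_ge0.
Qed.

(** The reduction g of f modulo m takes the same values as f at the roots of m,
    which are pairwise distinct and as many as the coefficients of g.  The
    inverse of their Vandermonde matrix bounds these coefficients in terms of
    K. *)
Lemma bounded_conjugates_finite (R : realType) (m : {poly int})
    (K : R[i] -> R[i]) :
  m \is monic -> irreducible_poly (map_poly intr m : {poly rat}) ->
  exists F : seq {poly int}, forall f : {poly int},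
    (forall z : R[i], root (map_poly intr m) z ->
       `|(map_poly intr f).[z]| <= K z) ->
    Pdiv.Ring.rmodp f m \in F.
Proof.
move=> m_monic m_irr.
have mC : map_poly intr m \is @monic R[i] by rewrite monic_map.
have [zs] := closed_field_poly_normal (map_poly intr m : {poly R[i]}).
rewrite (monicP mC) scale1r => mE.
have zs_uniq : uniq zs.
  rewrite -separable_prod_XsubC -mE.
  by rewrite -map_ratr_intr separable_map irreducible_rat_separable.
pose d := size zs.
have sm : size m = d.+1.
  have := congr1 (fun q : {poly R[i]} => size q) mE.
  rewrite size_prod_XsubC => <-; rewrite size_map_poly_id0//.
  by rewrite (monicP m_monic) oner_eq0.
pose a : 'rV[R[i]]_d := \row_j zs`_j.
pose V : 'M[R[i]]_d := Vandermonde d a.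
have V_unit : V \in unitmx.
  rewrite unitmxE unitfE det_Vandermonde; apply/prodf_neq0 => i _.
  apply/prodf_neq0 => j ij; rewrite !mxE subr_eq0 nth_uniq//.
  by rewrite gtn_eqF.
pose B0 k : R[i] := \sum_(j < d) K zs`_j * `|invmx V j k|.
have [B BP] : exists B : nat, forall k, `|B0 k| <= B%:R.
  have /choice[N NP] k := complex_norm_bound (B0 k).
  exists (\sum_k N k)%N => k; apply: le_trans (NP k) _.
  by rewrite ler_nat (bigD1 k)//= leq_addr.
have [F FP] := bounded_int_poly_finite d B.
exists F => f fK; set g := Pdiv.Ring.rmodp f m.
have m0 : m != 0 by rewrite monic_neq0.
have gd : (size g <= d)%N by rewrite -ltnS -sm Pdiv.Ring.ltn_rmodpN0.
apply: FP => // i id.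
have gz z : root (map_poly intr m) z ->
    (map_poly intr g).[z] = (map_poly intr f).[z] :> R[i].
  move=> mz; rewrite [in RHS](Pdiv.RingMonic.rdivp_eq m_monic f).
  by rewrite rmorphD rmorphM hornerD hornerM (eqP mz) mulr0 add0r.
have rz j : (j < d)%N -> root (map_poly intr m) zs`_j.
  by move=> jd; rewrite mE root_prod_XsubC mem_nth.
pose c : 'rV[R[i]]_d := \row_k (g`_k)%:~R.
have cV : c *m V = \row_j (map_poly intr f).[zs`_j].
  apply/rowP => j; rewrite !mxE -gz ?rz// (@horner_coef_wide _ d); last first.
    by rewrite (leq_trans (size_poly _ _)).
  by apply: eq_bigr => k _; rewrite !mxE coef_map.
have := congr1 (fun M => (M *m invmx V) 0 (Ordinal id)) cV.
rewrite mulmxK// !mxE /= => gi.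
have : `|(g`_i)%:~R| <= B%:R :> R[i].
  apply: le_trans (BP (Ordinal id)); rewrite gi.
  apply: le_trans (ler_norm_sum _ _ _) _.
  rewrite (@ger0_norm _ (B0 _)); last first.
    apply: sumr_ge0 => j _; rewrite mulr_ge0//.
    by apply: le_trans (fK _ (rz j _)).
  apply: ler_sum => j _; rewrite normrM ler_wpM2r// mxE.
  exact/fK/rz.
by rewrite -intr_norm pmulrn ler_int -abszE lez_nat.
Qed.

(** * Orbits of the alternate base recurrence *)

Lemma rat_poly_common_denominator (n : nat) (g : nat -> {poly rat}) :
  exists N : int, exists2 G : nat -> {poly int}, N != 0 &
    forall j, (j < n)%N -> map_poly intr (G j) = N%:~R *: g j.
Proof.
have /choice[qa qaP] j : exists qa : {poly int} * int,
    qa.2 != 0 /\ g j = qa.2%:~R^-1 *: map_poly intr qa.1.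
  by have [q [a a0 gE]] := rat_poly_scale (g j); exists (q, a).
pose a j := (qa j).2; have a0 j : a j != 0 by case: (qaP j).
exists (\prod_(i < n) a i).
exists (fun j => (\prod_(i < n | i != j :> nat) a i) *: (qa j).1).
  by apply/prodf_neq0 => i _.
move=> j jn; have [_ ->] := qaP j; rewrite -/(a j).
rewrite map_polyZ/= scalerA [in RHS](bigD1 (Ordinal jn))//= intrM mulrAC.
by rewrite mulfV ?mul1r// intr_eq0.
Qed.

(** Resets to 1 are allowed at any step: the sequences s of the value test and t
    of the greediness test are both of this form.

    The invariant, at position j = n mod p of the period, is that
    N c_j y_n = h(delta) for an integer polynomial h with
    |h(z)| <= K z + j D z at every conjugate z of delta other than delta itself.
    Here c_j is the product of the b_k with j <= k < p, and G_j is an integer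
    polynomial with G_j(delta) = N c_j.  Since c_j = b_j c_(j+1), a step adds to
    h a multiple of G_(j+1) which is at most D z at z, or at a reset replaces h
    by G_(j+1), which is within K z.  At the end of a period, passing from
    c_p = 1 to c_0 = delta multiplies h by the indeterminate. *)
Lemma pisot_orbit_finite (R : realType) (p : nat) (b : nat -> R) (M : nat)
    (C : R) :
  (0 < p)%N -> (forall n, b (n %% p)%N = b n) -> (forall n, b n != 0) ->
  pisot (\prod_(i < p) b i) ->
  (forall n, adjoinQ (\prod_(i < p) b i) (b n)) ->
  exists F : seq R, forall (y : nat -> R) (a : nat -> int),
    (y 0%N = 0 \/ y 0%N = 1) -> (forall n, (absz (a n) <= M)%N) ->
    (forall n, `|y n| <= C) ->
    (forall n, y n.+1 = b n * y n + (a n)%:~R \/ y n.+1 = 1) ->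
    forall n, y n \in F.
Proof.
move=> p0 b_per b0; set delta := \prod_(i < p) b i => -[dint _ dconj] bQ.
have [m [m_monic m_irr md]] := integral_irreducible_root dint.
have /choice[f fE] n : exists f : {poly rat}, b n = (map_poly ratr f).[delta].
  by apply: (adjoinQ_horner m_irr) => //; rewrite map_ratr_intr.
pose c j := \prod_(j <= k < p) b k.
have cS j : (j < p)%N -> c j = b j * c j.+1 by move=> jp; rewrite /c big_ltn.
have c0 : c 0%N = delta by rewrite /c big_mkord.
have cp : c p = 1 by rewrite /c big_geq.
have cN0 j : c j != 0.
  apply: (big_ind (fun x => x != 0)) => //; first exact: oner_neq0.
  exact: mulf_neq0.
have [N [G N0 GE]] :=
  rat_poly_common_denominator p.+1 (fun j => \prod_(j <= k < p) f k).
pose ev (h : {poly int}) : R := (map_poly intr h).[delta].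
pose evC (h : {poly int}) (z : R[i]) : R[i] := (map_poly intr h).[z].
have evG j : (j <= p)%N -> ev (G j) = N%:~R * c j.
  move=> jp; rewrite /ev -map_ratr_intr GE// map_polyZ hornerZ/= ratr_int.
  congr (_ * _); rewrite rmorph_prod horner_prod.
  by apply: eq_bigr => k _; rewrite fE.
have evCdelta h : evC h delta%:C%C = (ev h)%:C%C.
  rewrite /ev /evC -horner_map -map_poly_comp; congr (_.[_]).
  by apply: eq_map_poly => x /=; rewrite rmorph_int.
pose D z : R[i] := \sum_(j < p.+1) M.+1%:R * `|evC (G j) z|.
have D0 z : 0 <= D z by apply: sumr_ge0 => j _; rewrite mulr_ge0.
have GD j z : (j <= p)%N -> M.+1%:R * `|evC (G j) z| <= D z.
  move=> jp; rewrite /D (bigD1 (Ordinal (jp : (j < p.+1)%N)))//= lerDl.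
  by apply: sumr_ge0 => k _; rewrite mulr_ge0.
(* K z is large enough for |z| (K z + p D z) <= K z, as 1 - |z| > 0. *)
pose K z : R[i] := D z * p.+1%:R / (1 - `|z|).
pose E : R := \sum_(j < p.+1) `|N%:~R * c j| * C.
have [F0 F0P] := bounded_conjugates_finite
  (fun z => if z == delta%:C%C then E%:C%C else K z + p%:R * D z)
  m_monic m_irr.
have zlt1 (z : R[i]) : root (map_poly intr m) z -> z != delta%:C%C -> `|z| < 1.
  move=> mz; apply: dconj; exists (map_poly intr m); split => //.
  - by rewrite monic_map.
  - by rewrite map_ratr_intr.
  - by rewrite map_ratr_intr.
exists [seq ev g / (N%:~R * c j) | j <- iota 0 p, g <- F0].
move=> y a y0 aM yC yS n.
have C0 : 0 <= C by apply: le_trans (yC 0%N).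
have modp_lt k : (k %% p < p)%N by rewrite ltn_mod.
suff [h hE hK] : exists2 h, ev h = N%:~R * c (n %% p)%N * y n &
    forall z, root (map_poly intr m) z -> z != delta%:C%C ->
      `|evC h z| <= K z + (n %% p)%:R * D z.
  have Nc0 : N%:~R * c (n %% p)%N != 0 by rewrite mulf_neq0// intr_eq0.
  have yE : y n = ev (Pdiv.Ring.rmodp h m) / (N%:~R * c (n %% p)%N).
    apply: (mulfI Nc0); rewrite [RHS]mulrC divfK// -hE /ev.
    rewrite [in LHS](Pdiv.RingMonic.rdivp_eq m_monic h) rmorphD rmorphM.
    by rewrite hornerD hornerM (eqP md) mulr0 add0r.
  rewrite yE; apply: (@allpairs_f _ _ _ (fun j g => ev g / (N%:~R * c j))).
    by rewrite mem_iota /= add0n.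
  apply: F0P => z mz; case: eqVneq => [->|zd].
    rewrite -/(evC h _) evCdelta hE normc_def/= expr0n/= addr0 sqrtr_sqr lecR.
    have np : (n %% p < p.+1)%N by exact: ltnW (modp_lt n).
    rewrite normrM /E (bigD1 (Ordinal np))//=.
    rewrite (@le_trans _ _ (`|N%:~R * c (n %% p)%N| * C)) ?ler_wpM2l// lerDl.
    by apply: sumr_ge0 => k _; rewrite mulr_ge0.
  apply: le_trans (hK z mz zd) _; rewrite lerD2l ler_wpM2r// ler_nat ltnW//.
have K1 z : `|z| < 1 -> D z <= K z /\ `|z| * (K z + p%:R * D z) <= K z.
  move=> z1; have z1' : 0 < 1 - `|z| by rewrite subr_gt0.
  rewrite /K; split.
    rewrite ler_pdivlMr// ler_wpM2l//.
    by rewrite (@le_trans _ _ 1) ?ler1n// gerBl.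
  have KE : K z * (1 - `|z|) = D z * p.+1%:R by rewrite divfK// gt_eqF.
  rewrite -/(K z) [leRHS](_ : _ = `|z| * K z + D z * p.+1%:R); last first.
    by rewrite -KE; ring.
  rewrite mulrDr lerD2l [leRHS]mulrC mulrA ler_wpM2r//.
  rewrite (@le_trans _ _ (1 * p%:R))// ?ler_wpM2r ?(ltW z1)//.
  by rewrite mul1r ler_nat.
(* One step inside a period; the position (k mod p) + 1 may be p here. *)
have step k h : ev h = N%:~R * c (k %% p)%N * y k ->
    (forall z, root (map_poly intr m) z -> z != delta%:C%C ->
      `|evC h z| <= K z + (k %% p)%:R * D z) ->
    exists2 h1, ev h1 = N%:~R * c (k %% p).+1 * y k.+1 &
    forall z, root (map_poly intr m) z -> z != delta%:C%C ->
      `|evC h1 z| <= K z + (k %% p).+1%:R * D z.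
  move=> hE hK; case: (yS k) => ->.
    exists (h + a k *: G (k %% p).+1).
      rewrite /ev rmorphD/= hornerD map_polyZ hornerZ -/(ev h) -/(ev _) hE.
      by rewrite evG// cS// b_per; ring.
    move=> z mz zd; rewrite /evC rmorphD/= hornerD map_polyZ hornerZ.
    apply: le_trans (ler_normD _ _) _; rewrite -natr1 mulrDl addrA lerD ?hK//.
    rewrite mul1r normrM (le_trans _ (GD (k %% p).+1 z _))// ler_wpM2r//=.
    rewrite -intr_norm pmulrn ler_int -abszE lez_nat.
    by rewrite (leq_trans (aM k)).
  exists (G (k %% p).+1); first by rewrite evG// mulr1.
  move=> z mz zd; have [DK _] := K1 z (zlt1 z mz zd).
  have GDz : `|evC (G (k %% p).+1) z| <= D z.
    apply: le_trans (GD (k %% p).+1 z _) => //.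
    by rewrite ler_peMl// ler1n.
  by rewrite (le_trans GDz)// (le_trans DK)// lerDl mulr_ge0.
elim: n => [|n [h hE hK]].
  rewrite mod0n; case: y0 => ->.
    exists 0; first by rewrite /ev rmorph0 horner0 mulr0.
    move=> z mz zd; rewrite /evC rmorph0 horner0 normr0 mul0r addr0.
    by have [DK _] := K1 z (zlt1 z mz zd); rewrite (le_trans _ DK).
  exists (G 0%N); first by rewrite evG// mulr1.
  move=> z mz zd; have [DK _] := K1 z (zlt1 z mz zd).
  rewrite mul0r addr0 (le_trans _ DK)// (le_trans _ (GD 0%N z _))//.
  by rewrite ler_peMl// ler1n.
have [h1 h1E h1K] := step n h hE hK.
have [np|np] := ltnP (n %% p).+1 p.
  have nS : (n.+1 %% p = (n %% p).+1)%N.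
    by rewrite -addn1 -modnDml addn1 modn_small.
  by rewrite nS; exists h1.
have nE : (n %% p).+1 = p by apply/eqP; rewrite eqn_leq np modp_lt.
have nS : (n.+1 %% p = 0)%N.
  by rewrite -addn1 -modnDml addn1 nE modnn.
rewrite nS; exists ('X * h1).
  rewrite /ev rmorphM/= map_polyX hornerM hornerX -/(ev h1) h1E nE cp c0.
  by ring.
move=> z mz zd; rewrite /evC rmorphM/= map_polyX hornerM hornerX mul0r addr0.
have [_ DK] := K1 z (zlt1 z mz zd).
rewrite normrM (le_trans _ DK)// ler_wpM2l//.
by have := h1K z mz zd; rewrite nE.
Qed.

(** * The automaton *)

(** The sequence s tests the equality of the values, and t the greediness of
    v. *)
Definition normalization_run (R : realType) (b : nat -> R) (u v : nat -> int)
    (s t : nat -> R) : Prop :=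
  [/\ s 0%N = 0 /\ (forall n, s n.+1 = b n * s n + (u n - v n)%:~R),
      t 0%N = 1 /\ (forall n, t n.+1 = Num.min 1 (b n * t n - (v n)%:~R)),
      forall n, 0 < t n
    & forall N : nat, exists2 n, (N <= n)%N & 1 < b n * t n - (v n)%:~R].

Lemma beta_val_orbit (R : realType) (p : nat) (beta : p.-tuple R) (c C : R)
    (a : nat -> int) (y : nat -> R) :
  1 < c -> (forall n, c <= base beta n) -> (forall n, `|y n| <= C) ->
  (forall n, y n.+1 = base beta n * y n - (a n)%:~R) ->
  beta_val beta a = y 0%N.
Proof.
move=> c1 cb yC yS; apply/cvg_lim => //.
exact: (bounded_orbit_series_cvg c1 cb yC yS).
Qed.

Lemma digit_norm_le (R : realType) (M : nat) (a : int) :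
  (absz a <= M)%N -> `|a%:~R| <= M%:R :> R.
Proof. by move=> aM; rewrite -intr_norm pmulrn ler_int -abszE lez_nat. Qed.

(** If r is the bounded orbit of tails of v, then r - s is a bounded orbit for
    u, with the same initial term; so the values of u and v are equal. *)
Lemma run_normalizes (R : realType) (p : nat) (beta : p.-tuple R) (c C : R)
    (M : nat) (u v : nat -> int) (s t : nat -> R) :
  1 < c -> (forall n, c <= base beta n) ->
  (forall n, 0 <= v n) -> (forall n, (absz (v n) <= M)%N) ->
  (forall n, `|s n| <= C) -> normalization_run (base beta) u v s t ->
  beta_val beta u = beta_val beta v /\
  exists2 x : R, 0 <= x < 1 & forall n, v n = expansion beta x n.
Proof.
move=> c1 cb v0 vM sC [[s0 sS] [t0 tS] tpos reset].
have [r [rC rS]] :=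
  bounded_orbit_exists c1 cb (fun n => digit_norm_le R (vM n)).
have rt := lt_threshold c1 cb v0 rC rS tpos tS reset.
have t1 n : t n <= 1 by case: n => [|n]; rewrite ?t0// tS ge_min lexx.
have r01 n : 0 <= r n < 1.
  by have /andP[-> rn] := rt n; rewrite (lt_le_trans rn).
split; last by exists (r 0%N) => // n; apply: orbit_expansion.
rewrite (beta_val_orbit c1 cb rC rS).
rewrite (@beta_val_orbit _ _ _ c (M%:R / (c - 1) + C) _ (fun n => r n - s n))//.
- by rewrite s0 subr0.
- by move=> n; rewrite (le_trans (ler_normB _ _))// lerD.
- by move=> n; rewrite rS sS intrB; ring.
Qed.

Fixpoint threshold (R : realType) (b : nat -> R) (v : nat -> int) (n : nat) :
    R :=
  if n is m.+1 then Num.min 1 (b m * threshold b v m - (v m)%:~R) else 1.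

(** The greedy remainders and the tails of u are bounded orbits with the same
    initial term, and s is their difference; hence a bound on s which does not
    depend on the words. *)
Lemma normalizes_run (R : realType) (p : nat) (beta : p.-tuple R) (c : R)
    (M : nat) (u v : nat -> int) (x : R) :
  1 < c -> (forall n, c <= base beta n) -> (forall n, (absz (u n) <= M)%N) ->
  0 <= x < 1 -> (forall n, v n = expansion beta x n) ->
  beta_val beta u = beta_val beta v ->
  exists s t : nat -> R, normalization_run (base beta) u v s t /\
    forall n, `|s n| <= M%:R / (c - 1) + 1.
Proof.
move=> c1 cb uM x01 vE uv.
pose r := greedy_tail beta x.
have r01 n : 0 <= r n < 1 by exact: greedy_tail_itv.
have rS n : r n.+1 = base beta n * r n - (v n)%:~R.
  by rewrite vE; exact: greedy_tailS.
have r1 n : `|r n| <= 1.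
  by have /andP[r0 /ltW] := r01 n; rewrite ger0_norm.
have [y [yC yS]] :=
  bounded_orbit_exists c1 cb (fun n => digit_norm_le R (uM n)).
have y0 : y 0%N = r 0%N.
  by rewrite -(beta_val_orbit c1 cb yC yS) uv (beta_val_orbit c1 cb r1 rS).
have [rt reset] := @threshold_reset _ _ _ v r (threshold (base beta) v)
  c1 cb r01 rS erefl (fun=> erefl).
exists (fun n => r n - y n), (threshold (base beta) v); split.
  split => //.
  - by split=> [|n]; [rewrite y0 subrr|rewrite rS yS intrB; ring].
  - by move=> n; apply: le_lt_trans (rt n); have /andP[] := r01 n.
by move=> n; rewrite (le_trans (ler_normB _ _))// addrC lerD.
Qed.

Definition normalization_step (R : realType) (p : nat) (beta : p.-tuple R)
    (D : p.-tuple {fset int}) (F : seq R) (l : int * int)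
    (q q' : 'I_p * seq_sub F * seq_sub F * bool) : bool :=
  let: (i, s, t, _) := q in
  let: (i', s', t', reset) := q' in
  let z := base beta i * ssval t - l.2%:~R in
  [&& (i' == i.+1 %% p :> nat)%N, l.1 \in alphabet D i,
      l.2 \in digits (base beta i),
      ssval s' == base beta i * ssval s + (l.1 - l.2)%:~R,
      ssval t' == Num.min 1 z, 0 < ssval t' & reset == (1 < z)].

Definition normalization_automaton (R : realType) (p : nat) (beta : p.-tuple R)
    (D : p.-tuple {fset int}) (F : seq R) :
    finite_buchi (pair_alphabet beta D) :=
  @FiniteBuchi _ ('I_p * seq_sub F * seq_sub F * bool)%type
    [set q : 'I_p * seq_sub F * seq_sub F * bool | let: (i, s, t, _) := q in
       [&& i == 0%N :> nat, ssval s == 0 & ssval t == 1]]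
    [set q | q.2]
    [set e | normalization_step beta D (fsval e.1.2) e.1.1 e.2].

(** The bit of a state records whether the step leading to it was a reset,
    whence the shift by one between final states and resets. *)
Lemma normalization_automatonP (R : realType) (p : nat) (beta : p.-tuple R)
    (D : p.-tuple {fset int}) (F : seq R) (w : nat -> pair_alphabet beta D) :
  (0 < p)%N ->
  let u n := (fsval (w n)).1 in
  let v n := (fsval (w n)).2 in
  buchi_accepts (normalization_automaton beta D F) w <->
  [/\ forall n, u n \in alphabet D n, forall n, v n \in digits (base beta n)
    & exists s t : nat -> R, normalization_run (base beta) u v s t /\
        forall n, s n \in F /\ t n \in F].
Proof.
move=> p0 u v.
have bE n : base beta (n %% p)%N = base beta n by rewrite /base modn_mod.
have aE n : alphabet D (n %% p)%N = alphabet D n by rewrite /alphabet modn_mod.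
split=> [[q [q0 qS qF]]|[uD vD [s [t [[[s0 sS] [t0 tS] tpos reset] stF]]]]].
  pose i n := (q n).1.1.1; pose s n := ssval (q n).1.1.2.
  pose t n := ssval (q n).1.2.
  have qE n : q n = (i n, (q n).1.1.2, (q n).1.2, (q n).2).
    by rewrite /i; case: (q n) => -[[]].
  move: q0; rewrite inE qE => /and3P[/eqP i0 /eqP s0 /eqP t0].
  have step n := qS n; have {}step n :
    [/\ i n.+1 = ((i n).+1 %% p)%N :> nat, u n \in alphabet D (i n),
        v n \in digits (base beta (i n)),
        s n.+1 = base beta (i n) * s n + (u n - v n)%:~R &
        [/\ t n.+1 = Num.min 1 (base beta (i n) * t n - (v n)%:~R), 0 < t n.+1
          & (q n.+1).2 = (1 < base beta (i n) * t n - (v n)%:~R)]].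
    have := step n; rewrite inE /= (qE n) (qE n.+1) /=.
    by case/and5P=> /eqP ? ? ? /eqP ? /and3P[/eqP ? ? /eqP].
  have iE n : i n = (n %% p)%N :> nat.
    elim: n => [|n IHn]; first by rewrite i0 mod0n.
    by have [-> _ _ _ _] := step n; rewrite IHn -addn1 modnDml addn1.
  split=> [n|n|].
  - by have [_ + _ _ _] := step n; rewrite iE aE.
  - by have [_ _ + _ _] := step n; rewrite iE bE.
  exists s, t; split; last by move=> n; split; exact: ssvalP.
  split.
  - split=> // n; by have [_ _ _ + _] := step n; rewrite iE bE.
  - split=> // n; by have [_ _ _ _ [+ _ _]] := step n; rewrite iE bE.
  - case=> [|n]; first by rewrite /t t0.
    by have [_ _ _ _ []] := step n.
  move=> N; have [[//|n] Nn] := qF N.+1; rewrite inE.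
  by have [_ _ _ _ [_ _ ->]] := step n; rewrite iE bE; exists n.
pose q n : buchi_state (normalization_automaton beta D F) :=
  (Ordinal (ltn_pmod n p0), SeqSub (stF n).1, SeqSub (stF n).2,
   if n is m.+1 then 1 < base beta m * t m - (v m)%:~R else false).
exists q; split.
- by rewrite inE /= s0 t0 mod0n !eqxx.
- move=> n; rewrite inE /= -/(u n) -/(v n) bE aE uD vD sS tS !eqxx -tS tpos.
  by rewrite -[(n %% p).+1]addn1 modnDml addn1 eqxx.
by move=> N; have [n Nn tn] := reset N; exists n.+1; rewrite ?inE//= ltnW.
Qed.

Theorem theorem32 (R : realType) (p : nat) (hp : (0 < p)%N)
  (beta : p.-tuple R) (hbeta : forall i : 'I_p, 1 < tnth beta i)
  (D : p.-tuple {fset int}) (hD : forall i : 'I_p, 0 \in tnth D i)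
  (hpisot : pisot (\prod_(i < p) tnth beta i))
  (hfield : forall i : 'I_p,
      adjoinQ (\prod_(j < p) tnth beta j) (tnth beta i)) :
  normalization_buchi_computable beta D.
Proof.
have bE n : base beta n = tnth beta (Ordinal (ltn_pmod n hp)).
  by rewrite (tnth_nth 1).
have dE : \prod_(i < p) tnth beta i = \prod_(i < p) base beta i.
  apply: eq_bigr => i _; rewrite bE; congr tnth; apply/val_inj => /=.
  by rewrite modn_small.
have [c c1 cb] : exists2 c : R, 1 < c & forall n, c <= base beta n.
  have [//|i _ imin] :=
    @Order.TotalTheory.arg_minP _ _ _ (Ordinal hp) predT (tnth beta).
  by exists (tnth beta i) => // n; rewrite bE imin.
have [M MP] : exists M : nat, forall l : pair_alphabet beta D,
    (absz (fsval l).1 <= M)%N /\ (absz (fsval l).2 <= M)%N.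
  exists (\sum_(l : pair_alphabet beta D)
    (absz (fsval l).1 + absz (fsval l).2))%N.
  by move=> l; rewrite (bigD1 l)//=; lia.
pose C : R := M%:R / (c - 1) + 1.
have C1 : 1 <= C by rewrite lerDr divr_ge0// subr_ge0 ltW.
have [F FP] : exists F : seq R, forall (y : nat -> R) (a : nat -> int),
    (y 0%N = 0 \/ y 0%N = 1) -> (forall n, (absz (a n) <= M + M)%N) ->
    (forall n, `|y n| <= C) ->
    (forall n, y n.+1 = base beta n * y n + (a n)%:~R \/ y n.+1 = 1) ->
    forall n, y n \in F.
  apply: (pisot_orbit_finite (M + M) C hp).
  - by move=> n; rewrite /base modn_mod.
  - by move=> n; rewrite gt_eqF// (lt_le_trans _ (cb n))// (lt_trans _ c1).
  - by rewrite -dE.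
  - by move=> n; rewrite -dE bE.
exists (normalization_automaton beta D F); apply/seteqP; split=> w.
  move=> /(normalization_automatonP F w hp)[uD vD [s [t [run stF]]]].
  have v0 n : 0 <= (fsval (w n)).2.
    by have /imfsetP[k _ ->] := vD n.
  (* s is bounded because it takes its values in the finite set F. *)
  have [K KP] : exists K : R, forall n, `|s n| <= K.
    exists (\sum_(x <- F) `|x|) => n; have [sF _] := stF n.
    by rewrite (big_rem _ sF)/= lerDl sumr_ge0.
  have [uv vx] := run_normalizes c1 cb v0 (fun n => (MP (w n)).2) KP run.
  by split.
move=> [uD vD uv [x x01 vx]].
apply/(normalization_automatonP F w hp); split=> //.
have [s [t [run sC]]] :=
  normalizes_run c1 cb (fun n => (MP (w n)).1) x01 vx uv.
exists s, t; split=> // n; have [[s0 sS] [t0 tS] tpos _] := run; split.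
  apply: (FP s (fun n => (fsval (w n)).1 - (fsval (w n)).2)) => //.
  - by left.
  - by move=> k; have := MP (w k); lia.
  - by move=> k; left.
apply: (FP t (fun n => - (fsval (w n)).2)) => //.
- by right.
- by move=> k; have := MP (w k); lia.
- move=> k; rewrite gtr0_norm// (le_trans _ C1)//.
  by case: k => [|k]; rewrite ?t0// tS ge_min lexx.
move=> k; rewrite tS rmorphN/= minEle; case: ifP => _; [by right|by left].
Qed.
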